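(* Let $n\geq 1$ and let $a$ and $b_j,c_j,d_j$, $j=1,\dots,n$, be (nonzero complex) parameters such that the product $b_jc_jd_j$ is independent of $j$. Put $e=a^2/(b_jc_jd_j)$ (which is then independent of $j$). Then $$ \det_{1\leq j,k\leq n}\left(\frac{(b_j,c_j,d_j)_{k-1}}{(a/b_j,a/c_j,a/d_j)_{k-1}} \right) =\left(\frac{a}{e}\right)^{\binom n2}\prod_{j=2}^n \frac{(aq^{j-2})_{j-1}}{(eq^{j-2})_{j-1}} \det_{1\leq j,k\leq n}\left(\frac{(a/b_jc_j,\,a/b_jd_j,\,a/c_jd_j)_{k-1}} {(a/b_j,a/c_j,a/d_j)_{k-1}}\right). $$
   Context: Fix complex numbers $p,q$ with $|p|<1$. Define $\theta(x)=\prod_{j=0}^\infty(1-p^jx)(1-p^{j+1}/x)$ for $x\neq 0$, the elliptic shifted factorial $(a)_k=\theta(a)\theta(aq)\cdots\theta(aq^{k-1})$ (with $(a)_0=1$), and $(a_1,\dots,a_m)_k=(a_1)_k\cdots(a_m)_k$. Expressions such as $a/b_jc_j$ mean $a/(b_jc_j)$. The identity is understood for parameters where all denominators are nonzero. *)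

(* Defs.v *)
From HB Require Import structures.
From mathcomp Require Import all_boot all_order all_algebra.
From mathcomp Require Import complex.
From mathcomp Require Import all_classical all_reals all_analysis.
Set Implicit Arguments. Unset Strict Implicit. Unset Printing Implicit Defensive.
Import Order.TTheory GRing.Theory Num.Theory.
Import numFieldTopology.Exports numFieldNormedType.Exports.
Local Open Scope ring_scope.
Local Open Scope complex_scope.

(* the complex numbers over a real field R, with the complex modulus as norm
   (and the induced metric topology) *)
Definition C (R : realType) : numClosedFieldType := R[i].

Definition theta (R : realType) (p x : C R) : C R :=
  limn (fun N : nat => \prod_(j < N) ((1 - p ^+ j * x) * (1 - p ^+ j.+1 / x))).

Definition efac (R : realType) (p q a : C R) (k : nat) : C R :=
  \prod_(i < k) theta p (a * q ^+ i).

(* Main.v *)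
(* Put l = e / a, so that a / (b c) = l d and so on. The Frenkel-Turaev summation
   expresses column k of the right-hand matrix as a combination of columns 0..k
   of the left-hand matrix with coefficients independent of j, because these
   coefficients depend on b_j, c_j, d_j only through their product. The
   transition matrix is triangular with diagonal
   l^k (e q^(k-1))_k / (a q^(k-1))_k, which gives the formula when no
   theta(a q^i), i <= 2n - 4, vanishes. Otherwise the product on the right-hand
   side vanishes and the left-hand matrix has two proportional columns.

   The summation rests on the three-term relation for theta, that is, on
   Weierstrass' addition formula. By Jacobi's triple product,
   theta(x y) theta(x / y) = x (A(x) B(y) - B(x) A(y)) up to a constant factor,
   and the addition formula becomes the Pluecker relation for 2 x 2
   determinants. This is carried out on truncated sums, whose difference with
   the truncated products tends to 0 by Tannery's theorem. *)

Require Import Defs.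
From HB Require Import structures.
From mathcomp Require Import all_boot all_order all_algebra.
From mathcomp Require Import complex.
From mathcomp Require Import all_classical all_reals all_analysis.
From mathcomp Require Import zify ring lra.
Set Implicit Arguments. Unset Strict Implicit. Unset Printing Implicit Defensive.
Import Order.TTheory GRing.Theory Num.Theory.
Import numFieldTopology.Exports numFieldNormedType.Exports.
Import ComplexField.Normc.
Local Open Scope ring_scope.
Local Open Scope complex_scope.

(** * Convergence of complex sequences *)

Section Complex.
Variable R : realType.
Implicit Types (r : R) (z : C R).
Local Open Scope classical_set_scope.

Lemma norm_real_complex r : `|r%:C : C R| = `|r|%:C.
Proof. by rewrite normc_def /= expr0n /= addr0 sqrtr_sqr. Qed.

Lemma gt0_complexE (e : C R) : 0 < e -> exists2 r, 0 < r & e = r%:C.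
Proof.
case: e => x y; rewrite ltcE /= => /andP[/eqP -> x0].
by exists x.
Qed.

Lemma cvg_real_complex (u : nat -> R) (l : R) :
  u @ \oo --> l -> (fun n => (u n)%:C : C R) @ \oo --> (l%:C : C R).
Proof.
move=> ul; apply/cvgrPdist_lt => e /gt0_complexE [r r0 ->].
move/cvgrPdist_lt : ul => /(_ r r0); apply: filterS => n.
have -> : (l%:C : C R) - (u n)%:C = (l - u n)%:C by rewrite rmorphB.
by rewrite norm_real_complex ltcR.
Qed.

Lemma cvg_geometric_increments (u : nat -> R) (M rho : R) :
  0 <= rho < 1 -> (forall n, `|u n.+1 - u n| <= M * rho ^+ n) -> cvgn u.
Proof.
move=> /andP[rho0 rho1] H.
have E : u = (fun n => u 0%N + series (telescope u) n).
  by apply/funext => n; rewrite [in LHS](eq_sum_telescope u n).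
rewrite E; apply: is_cvgD; first exact: is_cvg_cst.
apply: normed_cvg; apply: (@series_le_cvg _ _ (geometric M rho)).
- by move=> n /=; rewrite normr_ge0.
- by move=> n /=; apply: le_trans (H n); rewrite normr_ge0.
- exact: H.
- by apply: is_cvg_geometric_series; rewrite ger0_norm.
Qed.

Lemma cvg_complex_geometric_increments (u : nat -> C R) (M rho : R) :
  0 <= rho < 1 -> (forall n, `|u n.+1 - u n| <= (M * rho ^+ n)%:C) -> cvgn u.
Proof.
move=> rho01 H.

have Re_u : cvgn (fun n => complex.Re (u n)).
  apply: (@cvg_geometric_increments _ M rho) => // n.
  rewrite -lecR; apply: le_trans (H n).
  by rewrite -(raddfB (@complex.Re R)) normc_ge_Re.
have Im_u : cvgn (fun n => complex.Im (u n)).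
  apply: (@cvg_geometric_increments _ M rho) => // n.
  rewrite -lecR; apply: le_trans (H n).
  (* The imaginary part of z is, up to sign, the real part of i z, and multiplication by i preserves
     the modulus. *)
  rewrite -(raddfB (@complex.Im R)) -normrN -ReiNIm.
  apply: le_trans (normc_ge_Re _) _.
  by rewrite normrM [X in _ * X <= _]normc_def /= expr0n expr1n add0r sqrtr1 mulr1.
have -> : u = (fun n => ((complex.Re (u n))%:C : C R) + 'i%C * (complex.Im (u n))%:C).
  by apply/funext => n; exact: complexE.
apply: is_cvgD; first by apply/cvg_ex; eexists; apply: cvg_real_complex Re_u.
apply: is_cvgMr.
by apply/cvg_ex; eexists; apply: cvg_real_complex Im_u.
Qed.

(** Dominated convergence for sums over index sets that vary with [n]. A finite list [t] captures
    the supremum of the finite sums of [D] up to [r / 2]: the terms in [t] tend to 0 one by one, and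
    any list disjoint from [t] has total below [r / 2]. *)
Lemma tannery (I : eqType) (D : I -> R) (B : R) (s : nat -> seq I)
    (f : nat -> I -> C R) :
  (forall i, 0 <= D i) ->
  (forall t : seq I, uniq t -> \sum_(i <- t) D i <= B) ->
  (forall n, uniq (s n)) ->
  (forall n i, `|f n i| <= (D i)%:C) ->
  (forall i, f ^~ i @ \oo --> (0 : C R)) ->
  (fun n => \sum_(i <- s n) f n i) @ \oo --> (0 : C R).
Proof.
move=> D0 DB us fD f0.
pose S := [set r : R | exists2 t : seq I, uniq t & r = \sum_(i <- t) D i]%classic.
have supS : has_sup S.
  split; first by exists 0; exists [::]; rewrite ?big_nil.
  by exists B => _ [t ut ->]; exact: DB.
apply/cvgr0Pnorm_lt => e /gt0_complexE [r r0 ->].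
have r20 : 0 < r / 2 by rewrite divr_gt0.
have [_ [t ut ->] ht] := @sup_adherent _ S (r / 2) r20 supS.
have tail (t' : seq I) : uniq t' -> (forall i, i \in t' -> i \notin t) ->
    \sum_(i <- t') D i < r / 2.
  move=> ut' disj.
  have utt : uniq (t ++ t').
    rewrite cat_uniq ut ut' andbT /=; apply/hasPn => i it'; exact: disj.
  have : \sum_(i <- t ++ t') D i <= sup S.
    by apply: (@sup_upper_bound _ S) => //; exists (t ++ t').
  rewrite big_cat /=; lra.
have small : forall l : seq I, forall x : R, 0 < x ->
    \forall n \near \oo, \sum_(i <- l) `|f n i| < x%:C.
  elim=> [|i l IHl] x x0.
    by apply: nearW => n; rewrite big_nil ltcR.
  have x20 : 0 < x / 2 by rewrite divr_gt0.
  have := f0 i => /cvgr0Pnorm_lt /(_ (x / 2)%:C); rewrite ltcR => /(_ x20).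
  apply: filterS2 (IHl _ x20) => n lt1 lt2.
  rewrite big_cons [x in _ < x%:C]splitr (rmorphD (real_complex R)).
  exact: ltrD lt2 lt1.
have := small t _ r20.
apply: filterS => n hn.
rewrite (bigID (fun i => i \in t)) /=.
apply: le_lt_trans (ler_normD _ _) _.
have -> : r%:C = (r / 2)%:C + (r / 2)%:C :> C R.
  by rewrite -(rmorphD (real_complex R)) -splitr.
apply: ltr_leD.
  apply: le_lt_trans (ler_norm_sum _ _ _) _; apply: le_lt_trans hn.
  rewrite -big_filter.
  have [t' pt'] : exists t', perm_eq t ([seq i <- s n | i \in t] ++ t').
    exists [seq i <- t | i \notin s n].
    apply: uniq_perm => //.
      rewrite cat_uniq !filter_uniq // andbT /=; apply/hasPn => i.
      by rewrite !mem_filter => /andP[/negPf -> _]; rewrite andbF.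
    by move=> i; rewrite mem_cat !mem_filter; case: (i \in t); case: (i \in s n).
  by rewrite (perm_big _ pt') big_cat /= lerDl; apply: sumr_ge0.
apply: le_trans (ler_norm_sum _ _ _) _.
rewrite -big_filter.
apply: le_trans (_ : (\sum_(i <- [seq i <- s n | i \notin t]) D i)%:C <= _).
  rewrite rmorph_sum; apply: ler_sum => i _; exact: fD.
rewrite lecR ltW // tail ?filter_uniq // => i.
by rewrite mem_filter => /andP[].
Qed.

End Complex.

(** * The infinite product *)

Section InfiniteProduct.
Variable R : realType.
Local Open Scope classical_set_scope.

Lemma norm_normc (z : C R) : `|z| = (normc z)%:C.
Proof. by []. Qed.

Lemma normc_ge0 (z : C R) : 0 <= normc z.
Proof. by rewrite -lecR -norm_normc normr_ge0. Qed.

Lemma cvg_complex_expr (p : C R) : `|p| < 1 -> (fun n => p ^+ n) @ \oo --> (0 : C R).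
Proof.
move=> p1; apply/cvgr0Pnorm_lt => e /gt0_complexE[r r0 ->].
have : (fun n => normc p ^+ n) @ \oo --> (0 : R).
  by apply: cvg_expr; rewrite ger0_norm ?normc_ge0 // -ltcR.
move/cvgr0Pnorm_lt => /(_ r r0); apply: filterS => n.
rewrite ger0_norm; last by rewrite exprn_ge0 // normc_ge0.
by rewrite -ltcR (rmorphXn (real_complex R)) normrX.
Qed.

(** Weierstrass' product inequality: in the induction, (1 - S)(1 - |u_N|) exceeds 1 - S - |u_N| by
    the nonnegative S |u_N|. *)
Lemma norm_prod_1sub_ge (u : nat -> C R) N :
  \sum_(j < N) `|u j| <= 1 -> 1 - \sum_(j < N) `|u j| <= `|\prod_(j < N) (1 - u j)|.
Proof.
elim: N => [|N IH]; first by rewrite !big_ord0 subr0 normr1.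
rewrite !big_ord_recr /= normrM => S1.
have S0 : 0 <= \sum_(j < N) `|u j| by apply: sumr_ge0.
have u1 : `|u N| <= 1 by apply: le_trans S1; rewrite lerDr.
have SN : \sum_(j < N) `|u j| <= 1 by apply: le_trans S1; rewrite lerDl.
apply: le_trans (_ : (1 - \sum_(j < N) `|u j|) * (1 - `|u N|) <= _).
  rewrite -subr_ge0; set S := \sum_(_ < _) _ in S0 *.
  have -> : (1 - S) * (1 - `|u N|) - (1 - (S + `|u N|)) = S * `|u N| by ring.
  by rewrite mulr_ge0.
apply: ler_pM; rewrite ?subr_ge0 //; first exact: IH.
by have := lerB_dist 1 (u N); rewrite normr1.
Qed.

Lemma norm_prod_1sub_le (u : nat -> C R) N :
  `|\prod_(j < N) (1 - u j)| * (1 - \sum_(j < N) `|u j|) <= 1.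
Proof.
suff: \prod_(j < N) (1 + `|u j|) * (1 - \sum_(j < N) `|u j|) <= 1.
  case: (boolP (0 <= 1 - \sum_(j < N) `|u j|)) => [S0|S0 _].
    apply: le_trans; apply: ler_wpM2r => //; rewrite normr_prod.
    apply: ler_prod => j _; rewrite normr_ge0 /=.
    by apply: le_trans (ler_normB _ _) _; rewrite normr1.
  (* The order on complex numbers is partial: this quantity is nonpositive because it is real and
     not nonnegative. *)
  have SR : 1 - \sum_(j < N) `|u j| \is Num.real.
    by apply: realB; rewrite ?real1 // ger0_real // sumr_ge0.
  apply: le_trans ler01; rewrite mulr_ge0_le0 //.
  by move: SR; rewrite realE (negPf S0).
elim: N => [|N IH]; first by rewrite !big_ord0 subr0 mulr1.
rewrite !big_ord_recr /=.
set P := \prod_(_ < N) _ in IH *; set S := \sum_(_ < N) _ in IH *.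
have P0 : 0 <= P by apply: prodr_ge0 => j _; rewrite addr_ge0.
have S0 : 0 <= S by apply: sumr_ge0.
apply: le_trans IH; rewrite -mulrA; apply: ler_wpM2l => //.
rewrite -subr_ge0.
have -> : 1 - S - (1 + `|u N|) * (1 - (S + `|u N|)) = `|u N| * (S + `|u N|) by ring.
by rewrite mulr_ge0 // addr_ge0.
Qed.

(** The finite shifted factorial (x; p)_N of base [p]. *)
Definition poch (p x : C R) (N : nat) : C R := \prod_(j < N) (1 - p ^+ j * x).

Lemma pochS p x N : poch p x N.+1 = poch p x N * (1 - p ^+ N * x).
Proof. by rewrite /poch big_ord_recr. Qed.

Lemma pochSl p x N : poch p x N.+1 = (1 - x) * poch p (p * x) N.
Proof.
rewrite /poch big_ord_recl expr0 mul1r; congr (_ * _).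
by apply: eq_bigr => j _; rewrite lift0 exprSr mulrA.
Qed.

Lemma pochD p x M N : poch p x (M + N) = poch p x M * poch p (p ^+ M * x) N.
Proof.
rewrite /poch big_split_ord; congr (_ * _).
by apply: eq_bigr => j _; rewrite /= exprD mulrA (mulrC (p ^+ j)).
Qed.

Section Convergence.
Variable p : C R.
Hypothesis p1 : `|p| < 1.

Lemma sum_norm_geometric x N : \sum_(j < N) `|p ^+ j * x| * (1 - `|p|) <= `|x|.
Proof.
have -> : \sum_(j < N) `|p ^+ j * x| * (1 - `|p|) = `|x| * (1 - `|p| ^+ N).
  elim: N => [|N IH]; first by rewrite big_ord0 expr0 subrr mulr0.
  by rewrite big_ord_recr /= IH normrM normrX exprS; ring.
by rewrite ler_piMr // gerBl exprn_ge0.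
Qed.

Lemma sum_norm_geometric_half x N : 2 * `|x| <= 1 - `|p| ->
  \sum_(j < N) `|p ^+ j * x| <= 2^-1.
Proof.
move=> hx; have p10 : 0 < 1 - `|p| by rewrite subr_gt0.
rewrite -(ler_pM2r p10) mulr_suml; apply: le_trans (sum_norm_geometric x N) _.
by rewrite -(ler_pM2l (ltr0Sn _ 1)) mulrA divff ?mul1r // pnatr_eq0.
Qed.

Lemma poch_small x N : 2 * `|x| <= 1 - `|p| -> 2^-1 <= `|poch p x N| <= 2.
Proof.
move=> hx; have S2 := sum_norm_geometric_half N hx.
have h2 : 1 - 2^-1 = 2^-1 :> C R by field.
have S2' : 2^-1 <= 1 - \sum_(j < N) `|p ^+ j * x| by rewrite -{1}h2 lerB.
apply/andP; split.
  apply: le_trans S2' _; apply: (@norm_prod_1sub_ge (fun j => p ^+ j * x)).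
  by apply: le_trans S2 _; rewrite invf_le1 // ler1n.
have := @norm_prod_1sub_le (fun j => p ^+ j * x) N.
rewrite -/(poch p x N) => h.
rewrite -(ler_pM2r (_ : 0 < 2^-1)) ?invr_gt0 // divff ?pnatr_eq0 //.
by apply: le_trans h; apply: ler_wpM2l.
Qed.

Lemma exists_small_tail x : exists K, 2 * `|p ^+ K * x| <= 1 - `|p|.
Proof.
have : (fun n => p ^+ n * x) @ \oo --> (0 : C R).
  by rewrite -(mul0r x); apply: cvgMr_tmp; exact: cvg_complex_expr.
move/cvgr0Pnorm_lt => /(_ ((1 - `|p|) / 2)).
rewrite divr_gt0 ?subr_gt0 // => /(_ isT) [K _ /(_ K (leqnn K))] /= h.
by exists K; rewrite mulrC -ler_pdivlMr // ltW.
Qed.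

(** Beyond index [K] the factors form a product of small argument, which [poch_small] bounds by 2.
    The moduli of the partial products up to [K], summed and doubled, then majorize both ranges of
    [N]. *)
Lemma poch_bounded x : exists M : R, forall N, `|poch p x N| <= M%:C.
Proof.
have [K hK] := exists_small_tail x.
exists (\sum_(i < K.+1) normc (poch p x i) * 2) => N.
rewrite rmorph_sum /=.
have step i : (i < K.+1)%N -> `|poch p x i| * 2 <= 
   \sum_(i < K.+1) (normc (poch p x i) * 2)%:C :> C R.
  move=> iK; rewrite (bigD1 (Ordinal iK)) //= rmorphM /= rmorph_nat.
  rewrite lerDl sumr_ge0 // => j _.
  by rewrite ler0c mulr_ge0 ?normc_ge0.
case: (leqP N K) => NK.
  by apply: le_trans (step N NK); rewrite ler_peMr // ler1n.
rewrite -(subnKC (ltnW NK)) pochD normrM.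
apply: le_trans (step K (ltnSn K)); apply: ler_wpM2l => //.
by have /andP[] := poch_small (N - K) hK.
Qed.

Lemma poch_inv_bounded x : (forall j, 1 - p ^+ j * x != 0) ->
  exists M : R, forall N, `|(poch p x N)^-1| <= M%:C.
Proof.
move=> x0; have [K hK] := exists_small_tail x.
exists (\sum_(i < K.+1) normc (poch p x i)^-1 * 2) => N.
rewrite rmorph_sum /=.
have step i : (i < K.+1)%N -> `|(poch p x i)^-1| * 2 <= 
   \sum_(i < K.+1) (normc (poch p x i)^-1 * 2)%:C :> C R.
  move=> iK; rewrite (bigD1 (Ordinal iK)) //= rmorphM /= rmorph_nat.
  rewrite lerDl sumr_ge0 // => j _.
  by rewrite ler0c mulr_ge0 ?normc_ge0.
case: (leqP N K) => NK.
  by apply: le_trans (step N NK); rewrite ler_peMr // ler1n.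
rewrite -(subnKC (ltnW NK)) pochD invfM normrM.
apply: le_trans (step K (ltnSn K)); apply: ler_wpM2l => //.
have /andP[h _] := poch_small (N - K) hK.
rewrite normfV -[leRHS]invrK lef_pV2 // posrE ?invr_gt0 //.
by apply: lt_le_trans h; rewrite invr_gt0.
Qed.

Lemma poch_cvg x : cvgn (poch p x).
Proof.
have [M hM] := poch_bounded x.
apply: (@cvg_complex_geometric_increments _ _ (M * normc x) (normc p)).
  by rewrite normc_ge0 -ltcR.
move=> N; rewrite pochS mulrBr mulr1 addrAC subrr add0r normrN.
have -> : (M * normc x * normc p ^+ N)%:C = M%:C * (`|p| ^+ N * `|x|) :> C R.
  by rewrite !rmorphM rmorphXn -mulrA (mulrC (_ ^+ _)).
by rewrite !normrM normrX; apply: ler_wpM2r => //; rewrite mulr_ge0 ?exprn_ge0.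
Qed.

Definition qpoch x : C R := limn (poch p x).

Lemma qpoch_shift x : qpoch x = (1 - x) * qpoch (p * x).
Proof.
have h1 : (fun N => poch p x N.+1) @ \oo --> qpoch x.
  by rewrite (cvg_shiftS (poch p x)); exact: poch_cvg.
have h2 : (fun N => poch p x N.+1) @ \oo --> (1 - x) * qpoch (p * x).
  under eq_fun do rewrite pochSl.
  by apply: cvgMl_tmp; exact: poch_cvg.
exact: (cvg_unique _ h1 h2).
Qed.

(** A zero limit would make the inverses of the partial products unbounded. *)
Lemma qpoch_neq0 x : (forall j, 1 - p ^+ j * x != 0) -> qpoch x != 0.
Proof.
move=> x0; apply/negP => /eqP L0.
have [M hM] := poch_inv_bounded x0.
have P0 N : poch p x N != 0 by apply/prodf_neq0 => j _.
have M0 : 0 < M%:C :> C R.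
  by apply: lt_le_trans (hM 0%N); rewrite normr_gt0 invr_neq0.
have /cvgr0Pnorm_lt : poch p x @ \oo --> (0 : C R) by rewrite -L0; exact: poch_cvg.
move=> /(_ (M%:C)^-1); rewrite invr_gt0 => /(_ M0)[K _ /(_ K (leqnn K))] /=.
have := hM K; rewrite normfV -[leRHS]invrK lef_pV2 ?posrE ?invr_gt0 ?normr_gt0 //.
by move=> /le_lt_trans h /h; rewrite ltxx.
Qed.

End Convergence.
End InfiniteProduct.

(** * The theta function *)

Section Theta.
Variable R : realType.
Local Open Scope classical_set_scope.
Variable p : C R.
Hypothesis p1 : `|p| < 1.

Definition thetaN (x : C R) (N : nat) : C R := poch p x N * poch p (p / x) N.

Lemma thetaN_cvg x : thetaN x @ \oo --> qpoch p x * qpoch p (p / x).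
Proof. by apply: cvgM; exact: poch_cvg. Qed.

Lemma thetaE x : theta p x = qpoch p x * qpoch p (p / x).
Proof.
rewrite /theta -(cvg_lim (@norm_hausdorff _ _) (@thetaN_cvg x)).
congr (limn _); apply/funext => N; rewrite /thetaN /poch -big_split /=.
by apply: eq_bigr => j _; rewrite exprSr mulrA.
Qed.

Lemma cvg_thetaN x : thetaN x @ \oo --> theta p x.
Proof. by rewrite thetaE; exact: thetaN_cvg. Qed.

Lemma theta_inv x : x != 0 -> theta p x^-1 = - x^-1 * theta p x.
Proof.
move=> x0; rewrite !thetaE invrK (qpoch_shift p1 x^-1) (qpoch_shift p1 x).
by field.
Qed.

Lemma theta_mulp x : x != 0 -> p != 0 -> theta p (p * x) = - x^-1 * theta p x.
Proof.
move=> x0 p0; rewrite !thetaE (qpoch_shift p1 x).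
have -> : p / (p * x) = x^-1 by field; apply/andP.
by rewrite (qpoch_shift p1 x^-1); field.
Qed.

Lemma theta_eq0 x : x != 0 -> theta p x = 0 ->
  exists j, p ^+ j * x = 1 \/ x = p ^+ j.
Proof.
move=> x0; rewrite thetaE => /eqP; rewrite mulf_eq0.
apply: contraPP => /forallNP H; apply/negP; rewrite negb_or.
rewrite !qpoch_neq0 // => j.
  have := H j.+1 => /not_orP[_ h]; apply/negP => /eqP h'; apply: h.
  apply: (mulIf (invr_neq0 x0)); rewrite divff // exprSr -mulrA.
  by apply/eqP; rewrite -subr_eq0 h'.
have := H j => /not_orP[h _]; apply/negP => /eqP h'; apply: h.
by apply/eqP; rewrite eq_sym -subr_eq0 h'.
Qed.

(** The roots of theta are powers of [p] and their inverses. For [w = 1] the claim is the inversion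
    formula; quasi-periodicity carries it from [v] to [p * v] and [v / p], changing only the
    monomial. *)
Lemma theta_divr_root w : w != 0 -> theta p w = 0 ->
  exists k : C R, exists m : int,
    k != 0 /\ forall x, x != 0 -> theta p (w / x) = k * x ^ m * theta p x.
Proof.
move=> w0 /(theta_eq0 w0) [j].
pose Q v := exists k : C R, exists m : int,
  k != 0 /\ forall x, x != 0 -> theta p (v / x) = k * x ^ m * theta p x.
have Q1 : Q 1.
  exists (-1), (-1); split; first by rewrite oppr_eq0 oner_eq0.
  by move=> x x0; rewrite div1r theta_inv // mulN1r exprN1.
have Qmul v : v != 0 -> p != 0 -> Q v -> Q (p * v).
  move=> v0 p0 [k [m [k0 hk]]]; exists (- k / v), (m + 1); split.
    by rewrite mulf_neq0 ?oppr_eq0 ?invr_eq0.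
  move=> x x0; rewrite -(mulrA p) theta_mulp ?mulf_neq0 ?invr_eq0 // hk //.
  by rewrite expfzDr // expr1z; field; apply/andP.
have Qdiv v : v != 0 -> p != 0 -> Q v -> Q (v / p).
  move=> v0 p0 [k [m [k0 hk]]]; exists (- k * v / p), (m - 1); split.
    by rewrite !mulf_neq0 ?oppr_eq0 ?invr_eq0.
  move=> x x0.
  have := @theta_mulp (v / p / x); rewrite !mulf_neq0 ?invr_eq0 // => /(_ isT p0).
  rewrite (_ : p * (v / p / x) = v / x); last by field; apply/andP.
  rewrite hk // => h.
  apply: (mulfI (_ : - (v / p / x)^-1 != 0)).
    by rewrite oppr_eq0 invr_eq0 !mulf_neq0 ?invr_eq0.
  rewrite -h expfzDr // exprN1; field; rewrite ?v0 ?p0 ?x0 //.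
have QX j' : p ^+ j' != 0 -> Q (p ^+ j').
  elim: j' => [|j' IH]; first by rewrite expr0.
  rewrite exprS mulf_eq0 negb_or => /andP[p0 pj0].
  by apply: Qmul => //; exact: IH.
have QXV j' : p ^+ j' != 0 -> Q (p ^+ j')^-1.
  elim: j' => [|j' IH]; first by rewrite expr0 invr1.
  rewrite exprSr mulf_eq0 negb_or => /andP[pj0 p0].
  by rewrite invfM; apply: Qdiv; rewrite ?invr_eq0 //; exact: IH.
case=> [h|w_eq]; last by rewrite w_eq; apply: QX; rewrite -w_eq.
have pj0 : p ^+ j != 0.
  by apply: contra_eq_neq h => ->; rewrite mul0r eq_sym oner_eq0.
by have -> : w = (p ^+ j)^-1; [apply: (mulfI pj0); rewrite h divff | exact: QXV].
Qed.
End Theta.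

(** * The finite Jacobi triple product *)

(** The number k(k - 1)/2 for every integer [k]: as [Negz n] is -(n + 1), its value there is C(n +
    2, 2). *)
Definition tri (k : int) : nat :=
  match k with Posz n => 'C(n, 2) | Negz n => 'C(n.+2, 2) end.

Lemma bin2_double n : ('C(n, 2) * 2 = n * n.-1)%N.
Proof. by case: n => [|n] //; rewrite mulnC -mul_bin_diag bin1. Qed.

Lemma tri_double k : (tri k)%:Z * 2 = k * (k - 1).
Proof.
case: k => n; rewrite /tri -(PoszM _ 2) bin2_double.
  by case: n => [|n] //=; rewrite PoszM; lia.
by rewrite NegzE PoszM /=; lia.
Qed.

Definition zrange (N : nat) : seq int :=
  [seq i%:Z - N%:Z | i <- iota 0 (N + N).+1].

Lemma mem_zrange N (k : int) : (k \in zrange N) = (`|k| <= N)%N.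
Proof.
apply/mapP/idP => [[n] | h].
  by rewrite mem_iota => /andP[_ hi] ->; lia.
by exists (absz (k + N%:Z)%R); rewrite ?mem_iota; lia.
Qed.

Lemma zrange_uniq N : uniq (zrange N).
Proof. by rewrite map_inj_uniq ?iota_uniq // => i j; lia. Qed.

Section JacobiTriple.
Variable R : realType.
Local Open Scope classical_set_scope.
Variable p : C R.
Hypotheses (p1 : `|p| < 1) (p0 : p != 0).

Lemma one_sub_expr_neq0 j : 1 - p ^+ j * p != 0.
Proof.
rewrite -exprSr subr_eq0 eq_sym; apply: contraTneq p1 => h.
have : `|p| ^+ j.+1 = 1 by rewrite -normrX h normr1.
by move/eqP; rewrite pexpr_eq1 // => /eqP ->; rewrite ltxx.
Qed.

Lemma poch_self_neq0 n : poch p p n != 0.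
Proof. by apply/prodf_neq0 => j _; exact: one_sub_expr_neq0. Qed.

(** The Gaussian binomial coefficient of base [p]. *)
Definition gbin n k : C R := poch p p n / (poch p p k * poch p p (n - k)).

Lemma gbinn0 n : gbin n 0 = 1.
Proof. by rewrite /gbin subn0 {2}/poch big_ord0 mul1r divff ?poch_self_neq0. Qed.

Lemma gbinnn n : gbin n n = 1.
Proof. by rewrite /gbin subnn {3}/poch big_ord0 mulr1 divff ?poch_self_neq0. Qed.

Lemma gbinS n k : (k < n)%N -> gbin n.+1 k.+1 = gbin n k.+1 + p ^+ (n - k) * gbin n k.
Proof.
move=> kn; rewrite /gbin subSS !(pochS p p n) !(pochS p p k).
rewrite -(subnSK kn) !(pochS p p (n - k.+1)).
have -> : p ^+ n = p ^+ k * p ^+ (n - k.+1).+1 by rewrite -exprD subnSK // subnKC // ltnW.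
have := one_sub_expr_neq0 (n - k.+1); have := one_sub_expr_neq0 k.
have := poch_self_neq0 k; have := poch_self_neq0 (n - k.+1).
rewrite exprS => ? ? ? ?; field; do ![apply/andP; split] => //.
Qed.

(** The q-binomial theorem. Multiplication by the new factor [1 - p ^+ n * z] raises the order of
    the coefficients through the Pascal rule [gbinS]. *)
Lemma rothe n (z : C R) :
  poch p z n = \sum_(k < n.+1) (-1) ^+ k * p ^+ 'C(k, 2) * gbin n k * z ^+ k.
Proof.
elim: n => [|n IH].
  by rewrite big_ord_recl big_ord0 /= gbinn0 /poch big_ord0 !expr0 !mulr1 addr0.
rewrite pochS IH mulrBr mulr1 [X in X - _ = _]big_ord_recl.
rewrite [X in _ - X * _ = _]big_ord_recr [in RHS]big_ord_recl [in RHS]big_ord_recr /=.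
rewrite !gbinn0 !gbinnn mulrDl mulr_suml.
under [in RHS]eq_bigr => k _ do
  rewrite gbinS // binS bin1 !exprD mulrDr mulrDl.
rewrite big_split /= addrA; set A := \sum_(_ < _) _; set B := \sum_(_ < _) _.
set A' := \sum_(_ < _) _; set B' := \sum_(_ < _) _.
have <- : A = A'.
  apply: eq_bigr => k _.
  by rewrite /bump leq0n add1n binS bin1 exprD !exprS !expr0; ring.
have -> : B' = - B.
  rewrite -sumrN; apply: eq_bigr => k _; rewrite !expr1.
  have -> : p ^+ n = p ^+ k * p ^+ (n - k) by rewrite -exprD subnKC // ltnW.
  by ring.
by rewrite /bump leq0n add1n binS bin1 exprD !exprS; ring.
Qed.

Definition bterm (x : C R) (k : int) : C R := (- x) ^ k * p ^+ tri k.

(** Factor by factor, 1 - x/p^i = (-x/p^i)(1 - p^i/x) for i from 1 to N; the powers of [p] collect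
    to C(N + 1, 2). *)
Lemma poch_negative_shift x N : x != 0 ->
  poch p (p ^- N * x) N = (- x) ^+ N / p ^+ 'C(N.+1, 2) * poch p (p / x) N.
Proof.
move=> x0; elim: N => [|N IH]; first by rewrite /poch !big_ord0 expr0 divr1 mulr1.
have -> : poch p (p ^- N.+1 * x) N.+1 =
    (1 - p ^- N.+1 * x) * poch p (p ^- N * x) N.
  rewrite pochSl exprS; congr (_ * poch _ _ _).
  have pN : p ^+ N != 0 by rewrite expf_neq0.
  by field; rewrite ?p0 ?pN.
rewrite IH pochS (binS N.+1 1) bin1 exprD !exprS.
have ? : p ^+ N != 0 by rewrite expf_neq0.
have ? : p ^+ 'C(N.+1, 2) != 0 by rewrite expf_neq0.
by field; rewrite ?p0 ?x0; do ?[apply/andP; split].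
Qed.

(** For |k| at most N, [jconst N] times this is the Gaussian binomial of 2N over N + k. So
    normalized it tends to 1 for fixed [k], and it stays bounded over all [N] and [k]. *)
Definition jweight (N : nat) (k : int) : C R :=
  poch p p N ^+ 2 / (poch p p (absz (N%:Z + k)%R) * poch p p (absz (N%:Z - k)%R)).

Definition jconst (N : nat) : C R := poch p p (N + N) / poch p p N ^+ 2.

(** Rothe's formula for 2N factors starting at [p ^- N * x]: the first half is inverted into the
    factors in [p / x], and the summation index is shifted by N. *)
Lemma finite_jacobi_triple x N : x != 0 ->
  thetaN p x N = jconst N * \sum_(k <- zrange N) jweight N k * bterm x k.
Proof.
move=> x0.
have ? : p ^+ N != 0 by rewrite expf_neq0.
have ? : p ^+ 'C(N.+1, 2) != 0 by rewrite expf_neq0.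
have := rothe (N + N) (p ^- N * x).
rewrite pochD poch_negative_shift // mulrA divff ?expf_neq0 // mul1r => h.
have -> : thetaN p x N = p ^+ 'C(N.+1, 2) / (- x) ^+ N *
    ((- x) ^+ N / p ^+ 'C(N.+1, 2) * poch p (p / x) N * poch p x N).
  have ? : (- x) ^+ N != 0 by rewrite expf_neq0 // oppr_eq0.
  by rewrite /thetaN; field; apply/andP.
rewrite h big_map /index_iota -[(N + N).+1 in RHS]subn0 -/(index_iota 0 _) big_mkord.
rewrite !mulr_sumr; apply: eq_bigr => i _; rewrite /jconst /jweight /gbin.
have iN : (i <= N + N)%N by rewrite -ltnS.
have -> : (absz (N%:Z + (i%:Z - N%:Z))%R) = i by lia.
have -> : (absz (N%:Z - (i%:Z - N%:Z))%R) = (N + N - i)%N by lia.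
have -> : bterm x (i%:Z - N%:Z) = p ^+ 'C(N.+1, 2) / (- x) ^+ N *
   ((- 1) ^+ i * p ^+ 'C(i, 2) * (p ^- N * x) ^+ i).
  rewrite /bterm expfzDr ?oppr_eq0 // -exprnP exprnN.
  have h1 := tri_double (i%:Z - N%:Z); set t := tri _ in h1 *.
  (* The exponents of [p] match: C(i - N, 2) + N i = C(N + 1, 2) + C(i, 2). *)
  have E : (t + N * i = 'C(N.+1, 2) + 'C(i, 2))%N.
    have h2 := bin2_double N.+1; have h3 := bin2_double i.
    move: h1 h2 h3; move: t ('C(N.+1, 2)) ('C(i, 2)) => t u v.
    by case: (nat_of_ord i) => [|k] /=; nia.
  have {E} : p ^+ t * p ^+ (N * i) = p ^+ 'C(N.+1, 2) * p ^+ 'C(i, 2).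
    by rewrite -!exprD E.
  have ? : p ^+ (N * i) != 0 by rewrite expf_neq0.
  move=> E; apply: (mulIf (_ : p ^+ (N * i) != 0)) => //.
  rewrite -(mulrA _ (p ^+ t)) E exprMn exprVn -exprM.
  have ? : (- x) ^+ N != 0 by rewrite expf_neq0 // oppr_eq0.
  have -> : (- x) ^+ i = (-1) ^+ i * x ^+ i by rewrite -exprMn mulN1r.
  by field; do ?[apply/andP; split].
have := poch_self_neq0 i; have := poch_self_neq0 (N + N - i).
have := poch_self_neq0 N => ? ? ?.
have ? : (- x) ^+ N != 0 by rewrite expf_neq0 // oppr_eq0.
field; do ![apply/andP; split] => //.
Qed.

End JacobiTriple.

(** * Weierstrass' addition formula *)

(* Without this, unification unrolls [zrange N] into an explicit list. *)
Opaque zrange.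

Lemma sum_subseq_mem (V : nmodType) (I : eqType) (t U : seq I) (F : I -> V) :
  uniq t -> uniq U -> {subset t <= U} ->
  \sum_(i <- t) F i = \sum_(i <- U | i \in t) F i.
Proof.
move=> ut uU tU; rewrite -[RHS]big_filter; apply: perm_big.
apply: uniq_perm; rewrite ?filter_uniq // => i; rewrite mem_filter.
by case: (boolP (i \in t)) => // /tU ->.
Qed.

Lemma exprzN_sign (K : fieldType) (z : K) (k : int) : (- z) ^ k = (-1) ^ k * z ^ k.
Proof. by rewrite -[- z]mulN1r expfzMl. Qed.

(** The Pluecker relation for the minors of the matrix with rows [A] and [B] and columns x, y, u, v;
    the monomial prefactors amount to [x * u] in every term. *)
Lemma plucker_identity (K : fieldType) (A B : K -> K) (x y u v : K) : y != 0 ->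
  x * (A x * B y - B x * A y) * (u * (A u * B v - B u * A v))
  - x * (A x * B v - B x * A v) * (u * (A u * B y - B u * A y))
  = u / y * (y * (A y * B v - B y * A v) * (x * (A x * B u - B x * A u))).
Proof. by move=> y0; field. Qed.

Lemma divr_identity (K : fieldType) (h a b c d e f w : K) : h != 0 ->
  a / h * (b / h) - c / h * (d / h) = w * (e / h * (f / h)) ->
  a * b - c * d = w * (e * f).
Proof.
move=> h0 E; apply: (mulIf (_ : (h ^+ 2)^-1 != 0)); first by rewrite invr_eq0 expf_neq0.
transitivity (a / h * (b / h) - c / h * (d / h)); first by field.
by rewrite E; field.
Qed.

Lemma expN1_double (K : fieldType) (k : int) : (-1 : K) ^ (2 * k) = 1.
Proof.
have E : (-1 : K) ^ (2 : int) = 1 by rewrite -[LHS]/((-1) ^+ 2) sqrrN expr1n.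
by rewrite -exprz_exp E exp1rz.
Qed.

(** * Summable majorants for the bilateral theta series *)

Section Majorant.
Variable R : realType.
Local Open Scope classical_set_scope.

(** The Gaussian factor beats geometric growth: [v], which already includes 2^n, has ratio
    [2 * X * rho ^+ n], eventually at most 1, so finitely many of its terms bound all of them. *)
Lemma gauss_majorant (rho X : R) : 0 <= rho < 1 -> 0 <= X ->
  exists2 M : R, 0 <= M & forall n, X ^+ n * rho ^+ 'C(n, 2) <= M / 2 ^+ n.
Proof.
move=> /andP[rho0 rho1] X0.
pose v n := (2 * X) ^+ n * rho ^+ 'C(n, 2).
have v0 n : 0 <= v n by rewrite mulr_ge0 // exprn_ge0 // mulr_ge0.
have vS n : v n.+1 = 2 * X * rho ^+ n * v n.
  by rewrite /v binS bin1 exprD exprS; ring.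
have [K hK] : exists K, forall n, (K <= n)%N -> 2 * X * rho ^+ n <= 1.
  have : (fun n => 2 * X * rho ^+ n) @ \oo --> (0 : R).
    rewrite -(mulr0 (2 * X)); apply: cvgMl_tmp; apply: cvg_expr.
    by rewrite ger0_norm.
  move/cvgr0Pnorm_lt => /(_ 1 ltr01) [K _ hK]; exists K => n Kn.
  have /ltW := hK n Kn; apply: le_trans; exact: ler_norm.
exists (\sum_(i < K.+1) v i) => [|n]; first by apply: sumr_ge0.
rewrite ler_pdivlMr ?exprn_gt0 // mulrAC -exprMn (mulrC X) -/(v n).
elim: n => [|n IH]; first by rewrite (bigD1 ord0) //= lerDl sumr_ge0.
case: (leqP n.+1 K) => nK.
  by rewrite (bigD1 (Ordinal (nK : n.+1 < K.+1)%N)) //= lerDl sumr_ge0.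
apply: le_trans IH; rewrite vS; exact: ler_piMl (hK _ nK).
Qed.

Definition geo (k : int) : R := 2^-1 ^+ absz k.

Lemma geo_ge0 k : 0 <= geo k.
Proof. by rewrite exprn_ge0. Qed.

(** The right-hand side is the exact value of the sum, which lets the induction close. *)
Lemma sum_geo_zrange N : \sum_(k <- zrange N) geo k <= 3 - 2 * 2^-1 ^+ N.
Proof.
elim: N => [|N IH].
  have -> : zrange 0 = [:: 0] by [].
  rewrite big_seq1 /geo expr0; lra.
have P : perm_eq (zrange N.+1) (N.+1%:Z :: - N.+1%:Z :: zrange N).
  apply: uniq_perm; first exact: zrange_uniq.
    by rewrite 2!cons_uniq zrange_uniq in_cons !mem_zrange; lia.
  by move=> k; rewrite mem_zrange 2!in_cons mem_zrange; lia.
rewrite (perm_big _ P) 2!big_cons /geo abszN absz_nat.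
move: IH; rewrite /geo exprS; set x := 2^-1 ^+ N; set S := \sum_(_ <- _) _.
rewrite /=; lra.
Qed.

Lemma zrange_cover (t : seq (int * int)) : exists N,
  {subset t <= [seq (m, n) | m <- zrange N, n <- zrange N]}.
Proof.
exists (\sum_(z <- t) (absz z.1 + absz z.2))%N => -[m n] mnt.
apply/allpairsP; exists (m, n); rewrite !mem_zrange /=.
by rewrite (big_rem _ mnt) /=; split => //; lia.
Qed.

Lemma sum_geo_pair (t : seq (int * int)) : uniq t ->
  \sum_(z <- t) geo z.1 * geo z.2 <= 9.
Proof.
move=> ut; have [N tN] := zrange_cover t.
have uN : uniq [seq (m, n) | m <- zrange N, n <- zrange N].
  by apply: allpairs_uniq; rewrite ?zrange_uniq // => -[? ?] [? ?].
rewrite (sum_subseq_mem _ ut uN tN).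
apply: le_trans (_ : \sum_(z <- [seq (m, n) | m <- zrange N, n <- zrange N])
   geo z.1 * geo z.2 <= _).
  rewrite big_mkcond; apply: ler_sum => z _; case: ifP => // _.
  by rewrite mulr_ge0 ?geo_ge0.
rewrite big_allpairs_dep /=.
under eq_bigr do rewrite -mulr_sumr.
rewrite -mulr_suml; have := sum_geo_zrange N.
have : 0 <= \sum_(k <- zrange N) geo k by apply: sumr_ge0 => k _; rewrite geo_ge0.
set S := \sum_(_ <- _) _ => S0 hS; have : S <= 3.
  by apply: le_trans hS _; rewrite gerBl mulr_ge0 // exprn_ge0.
nra.
Qed.

End Majorant.

Section Weierstrass.
Variable R : realType.
Local Open Scope classical_set_scope.
Variable p : C R.
Hypotheses (p1 : `|p| < 1) (p0 : p != 0).

Lemma bterm_majorant x : x != 0 ->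
  exists2 M : R, 0 <= M & forall k, `|bterm p x k| <= (M * geo R k)%:C.
Proof.
move=> x0.
have rho : 0 <= normc p < 1 by rewrite normc_ge0 -ltcR.
have [M1 M10 h1] := gauss_majorant rho (normc_ge0 x).
have [M2 M20 h2] := gauss_majorant rho (normc_ge0 (p / x)).
exists (M1 + M2) => [|[] n]; first exact: addr_ge0.
- have -> : `|bterm p x n| = (normc x ^+ n * normc p ^+ 'C(n, 2))%:C.
    by rewrite /bterm /= -exprnP normrM !normrX normrN rmorphM !rmorphXn.
  rewrite lecR; apply: le_trans (h1 n) _; rewrite /geo exprVn.
  by apply: ler_wpM2r; rewrite ?invr_ge0 ?exprn_ge0 // lerDl.
- have -> : bterm p x (Negz n) = (- (p / x)) ^+ n.+1 * p ^+ 'C(n.+1, 2).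
    rewrite /bterm /tri (binS n.+1 1) bin1 exprD -mulrN -invrN exprMn exprVn.
    by rewrite -[_ ^ Negz n]/((- x) ^- n.+1); ring.
  have -> : `|(- (p / x)) ^+ n.+1 * p ^+ 'C(n.+1, 2)| =
      (normc (p / x) ^+ n.+1 * normc p ^+ 'C(n.+1, 2))%:C.
    by rewrite normrM !normrX normrN rmorphM !rmorphXn.
  rewrite lecR; apply: le_trans (h2 n.+1) _; rewrite /geo exprVn.
  by apply: ler_wpM2r; rewrite ?invr_ge0 ?exprn_ge0 // lerDr.
Qed.

Lemma cvg_sqr (u : nat -> C R) (l : C R) : u @ \oo --> l -> (fun N => u N ^+ 2) @ \oo --> l ^+ 2.
Proof. by move=> ul; under eq_fun do rewrite expr2; rewrite expr2; apply: cvgM. Qed.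

Lemma jweight_bounded : exists2 W : R, 0 <= W & forall N k, `|jweight p N k| <= W%:C.
Proof.
have [M hM] := poch_bounded p1 p.
have [M' hM'] := poch_inv_bounded p1 (one_sub_expr_neq0 p1).
exists (M ^+ 2 * M' ^+ 2) => [|N k]; first by rewrite mulr_ge0 ?sqr_ge0.
rewrite /jweight normrM normrX rmorphM !rmorphXn; apply: ler_pM => //.
  by rewrite ler_pXn2r // nnegrE ?normr_ge0 //; apply: le_trans (hM 0%N).
by rewrite invfM normrM expr2; apply: ler_pM.
Qed.

Lemma cvg_jweight k : jweight p ^~ k @ \oo --> (1 : C R).
Proof.
have L0 : qpoch p p != 0 by apply: qpoch_neq0 => // j; exact: one_sub_expr_neq0.
have sh (k' : int) : (fun N => poch p p (absz (N%:Z + k')%R)) @ \oo --> qpoch p p.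
  apply: (@cvg_comp _ _ _ (fun N => absz (N%:Z + k')%R) (poch p p) _ \oo);
    last exact: poch_cvg.
  move=> A [n _ hA]; exists (n + absz k')%N => //= m /= h.
  by apply: hA => /=; lia.
rewrite /jweight.
have -> : (1 : C R) = qpoch p p ^+ 2 / (qpoch p p * qpoch p p).
  by rewrite -expr2 divff // expf_neq0.
apply: cvgM; first by apply: cvg_sqr; exact: poch_cvg.
by apply: cvgV; [rewrite mulf_neq0 | apply: cvgM; exact: sh].
Qed.

Lemma cvg_jconst : exists2 h : C R, h != 0 & jconst p @ \oo --> h.
Proof.
have L0 : qpoch p p != 0 by apply: qpoch_neq0 => // j; exact: one_sub_expr_neq0.
exists (qpoch p p / qpoch p p ^+ 2); first by rewrite mulf_neq0 ?invr_eq0 ?expf_neq0.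
apply: cvgM; last first.
  by apply: cvgV; [rewrite expf_neq0 | apply: cvg_sqr; exact: poch_cvg].
apply: (@cvg_comp _ _ _ (fun N => N + N)%N (poch p p) _ \oo);
  last exact: poch_cvg.
move=> A [n _ hA]; exists n => //= m /= h; apply: hA => /=; lia.
Qed.

(** The terms of the functions B (even powers of [x]) and A (odd powers, one factor [x] being left
    to [bracket]) of the determinantal form of theta(x y) theta(x / y). *)
Definition even_term (x : C R) (i : int) : C R := p ^ (i * i) * x ^ (2 * i).
Definition odd_term (x : C R) (i : int) : C R := p ^ (i * i + i) * x ^ (2 * i + 1).
Definition even_sum N x : C R := \sum_(i <- zrange N) even_term x i.
Definition odd_sum N x : C R := \sum_(i <- zrange N) odd_term x i.
Definition bracket N x y : C R :=
  x * (odd_sum N x * even_sum N y - even_sum N x * odd_sum N y).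

Definition bpair x y (z : int * int) : C R := bterm p (x * y) z.1 * bterm p (x / y) z.2.

Definition zpairs N : seq (int * int) := [seq (i, j) | i <- zrange N, j <- zrange N].
Definition phi0 (z : int * int) : int * int := (z.1 + 1 + z.2, z.1 + 1 - z.2).
Definition phi1 (z : int * int) : int * int := (z.1 + z.2 + 1, z.1 - z.2).
(* The pairs [(m, n)] with [m + n] even (resp. odd) are the values of [phi0]
   (resp. [phi1]). *)
Definition diamond N := map phi0 (zpairs N) ++ map phi1 (zpairs N).

Lemma mem_zpairs N m n : ((m, n) \in zpairs N) = (absz m <= N)%N && (absz n <= N)%N.
Proof.
rewrite -!mem_zrange; apply/allpairsP/andP => [[[m' n'] /= [hm hn [-> ->]]] //|[hm hn]].
by exists (m, n).
Qed.

Lemma zpairs_uniq N : uniq (zpairs N).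
Proof. by apply: allpairs_uniq; rewrite ?zrange_uniq // => -[? ?] [? ?]. Qed.

Opaque zpairs.

Lemma diamond_uniq N : uniq (diamond N).
Proof.
rewrite cat_uniq; apply/and3P; split.
- rewrite map_inj_uniq ?zpairs_uniq //.
  by move=> [a b] [c d] [] *; congr (_, _); lia.
- apply/hasPn => _ /mapP[[a b] _ ->]; apply/negP => /mapP[[c d] _].
  by rewrite /phi0 /phi1 => -[] *; lia.
- rewrite map_inj_uniq ?zpairs_uniq //.
  by move=> [a b] [c d] [] *; congr (_, _); lia.
Qed.

(** Every fixed pair lies in the diamond for large [N]; its preimage is found by halving m + n
    according to parity. *)
Lemma mem_diamond N m n : (absz m + absz n < N)%N -> (m, n) \in diamond N.
Proof.
move=> h; rewrite mem_cat; apply/orP.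
have [[k hk]|[k hk]] : (exists k : int, m + n = 2 * k) \/ (exists k : int, m + n = 2 * k + 1).
  have := divz_eq (m + n) 2; have : (0 <= ((m + n) %% 2)%Z < 2) by rewrite modz_ge0 ?ltz_pmod.
  move=> h1 h2; have [h3|h3] : ((m + n) %% 2)%Z = 0 \/ ((m + n) %% 2)%Z = 1 by lia.
    by left; exists ((m + n) %/ 2)%Z; lia.
  by right; exists ((m + n) %/ 2)%Z; lia.
- left; apply/mapP; exists (k - 1, m - k); first by rewrite mem_zpairs; lia.
  by rewrite /phi0 /=; congr (_, _); lia.
- right; apply/mapP; exists (k, m - k - 1); first by rewrite mem_zpairs; lia.
  by rewrite /phi1 /=; congr (_, _); lia.
Qed.

Lemma bpairE x y m n : x != 0 -> y != 0 -> bpair x y (m, n) =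
  (-1) ^ (m + n) * x ^ (m + n) * y ^ (m - n) * p ^ ((tri m)%:Z + (tri n)%:Z).
Proof.
move=> x0 y0.
rewrite /bpair /bterm /= (exprzN_sign (x * y)) (exprzN_sign (x / y)) !expfzMl exprz_inv.
have N10 : (-1 : C R) != 0 by rewrite oppr_eq0 oner_eq0.
rewrite (expfzDr m n N10) (expfzDr m n x0) (expfzDr m (- n) y0) (expfzDr _ _ p0).
rewrite mulrACA; congr (_ * _).
by rewrite mulrACA -[RHS]mulrA; congr (_ * _); exact: mulrACA.
Qed.

(** Since C(m, 2) + C(n, 2) = ((m + n)^2 + (m - n)^2)/4 - (m + n)/2, each term separates into a
    function of m + n, carrying [x], and one of m - n, carrying [y]. The sign (-1)^(m + n) is +1
    here and -1 for [phi1], whence the difference in [bracket]. *)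
Lemma bpair_phi0 x y z : x != 0 -> y != 0 -> bpair x y (phi0 z) =
  x * (odd_term x z.1 * even_term y z.2).
Proof.
move=> x0 y0; case: z => i j; rewrite bpairE // /odd_term /even_term /=.
have -> : (tri (i + 1 + j)%R)%:Z + (tri (i + 1 - j)%R)%:Z = i * i + i + j * j.
  have := tri_double (i + 1 + j); have := tri_double (i + 1 - j).
  move: (tri _) (tri _) => a b ha hb; nia.
have -> : i + 1 + j + (i + 1 - j) = 1 + (2 * i + 1) by ring.
have -> : i + 1 + j - (i + 1 - j) = 2 * j by ring.
have -> : (-1) ^ (1 + (2 * i + 1)) = 1 :> C R.
  have -> : 1 + (2 * i + 1) = 2 * (i + 1) by ring.
  by rewrite expN1_double.
rewrite [x ^ (1 + _)]expfzDr // [p ^ (_ + j * j)]expfzDr // expr1z.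
by move: (x ^ _) (y ^ _) (p ^ (i * i + i)) (p ^ (j * j)) => s t u v; ring.
Qed.

Lemma bpair_phi1 x y z : x != 0 -> y != 0 -> bpair x y (phi1 z) =
  - (x * (even_term x z.1 * odd_term y z.2)).
Proof.
move=> x0 y0; case: z => i j; rewrite bpairE // /odd_term /even_term /=.
have -> : (tri (i + j + 1)%R)%:Z + (tri (i - j)%R)%:Z = i * i + (j * j + j).
  have := tri_double (i + j + 1); have := tri_double (i - j).
  move: (tri _) (tri _) => a b ha hb; nia.
have -> : i + j + 1 + (i - j) = 1 + 2 * i by ring.
have -> : i + j + 1 - (i - j) = 2 * j + 1 by ring.
have -> : (-1) ^ (1 + 2 * i) = -1 :> C R.
  rewrite expfzDr ?oppr_eq0 ?oner_eq0 // expr1z.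
  by rewrite expN1_double mulr1.
rewrite [x ^ (1 + _)]expfzDr // [p ^ (_ + (j * j + j))]expfzDr // expr1z.
by move: (x ^ _) (y ^ _) (p ^ (i * i)) (p ^ (j * j + j)) => s t u v; ring.
Qed.

Lemma sum_zpairs N (f g : int -> C R) :
  \sum_(z <- zpairs N) f z.1 * g z.2 =
  (\sum_(i <- zrange N) f i) * (\sum_(j <- zrange N) g j).
Proof.
rewrite big_allpairs_dep /= mulr_suml; apply: eq_bigr => i _.
by rewrite mulr_sumr.
Qed.

Lemma bracketE N x y : x != 0 -> y != 0 ->
  bracket N x y = \sum_(z <- diamond N) bpair x y z.
Proof.
move=> x0 y0; rewrite big_cat !big_map /=.
under eq_bigr do rewrite bpair_phi0 //.
under [X in _ + X]eq_bigr do rewrite bpair_phi1 //.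
rewrite sumrN -!mulr_sumr (sum_zpairs N (odd_term x) (even_term y)).
by rewrite (sum_zpairs N (even_term x) (odd_term y)) /bracket mulrBr.
Qed.

Lemma thetaN_mul N x y : x != 0 -> y != 0 ->
  thetaN p (x * y) N * thetaN p (x / y) N = jconst p N ^+ 2 *
  \sum_(z <- zpairs N) jweight p N z.1 * jweight p N z.2 * bpair x y z.
Proof.
move=> x0 y0; rewrite !finite_jacobi_triple ?mulf_neq0 ?invr_eq0 //.
rewrite mulrACA -expr2; set F := fun k => jweight p N k * bterm p (x * y) k.
set G := fun k => jweight p N k * bterm p (x / y) k.
rewrite -(sum_zpairs N F G); congr (_ * _); apply: eq_bigr => z _.
by rewrite /F /G /bpair mulrACA.
Qed.

(* Both sums exhaust the same absolutely summable double series, over squares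
   and over diamonds respectively. *)
Lemma cvg_bracket_diff x y : x != 0 -> y != 0 ->
  (fun N => \sum_(z <- zpairs N) jweight p N z.1 * jweight p N z.2 * bpair x y z
    - bracket N x y) @ \oo --> (0 : C R).
Proof.
move=> x0 y0.
have [M1 M10 h1] := bterm_majorant (mulf_neq0 x0 y0).
have xy0 : x / y != 0 by rewrite mulf_neq0 ?invr_eq0.
have [M2 M20 h2] := bterm_majorant xy0.
have [W W0 hW] := jweight_bounded.
pose s N := undup (zpairs N ++ diamond N).
pose f N z := (if z \in zpairs N then jweight p N z.1 * jweight p N z.2 * bpair x y z else 0)
   - (if z \in diamond N then bpair x y z else 0).
have E N : \sum_(z <- zpairs N) jweight p N z.1 * jweight p N z.2 * bpair x y z
    - bracket N x y = \sum_(z <- s N) f N z.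
  rewrite bracketE // (@sum_subseq_mem _ _ (zpairs N) (s N)) ?zpairs_uniq ?undup_uniq //;
    last by move=> z hz; rewrite mem_undup (mem_cat z (zpairs N)) hz.
  rewrite (@sum_subseq_mem _ _ (diamond N) (s N)) ?diamond_uniq ?undup_uniq //;
    last by move=> z hz; rewrite mem_undup (mem_cat z (zpairs N)) hz orbT.
  by rewrite !(big_mkcond (fun z => z \in _)) -sumrB.
under eq_fun do rewrite E.
(* [W ^+ 2] accounts for the weighted terms over the square, 1 for those over the diamond. *)
pose K := M1 * M2 * (W ^+ 2 + 1).
have bnd z : `|bpair x y z| <= (M1 * M2 * (geo R z.1 * geo R z.2))%:C.
  rewrite mulrACA rmorphM normrM; exact: ler_pM (h1 _) (h2 _).
apply: (@tannery _ _ (fun z => K * (geo R z.1 * geo R z.2)) (K * 9)).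
- by move=> z; rewrite /K !mulr_ge0 ?addr_ge0 ?geo_ge0 ?sqr_ge0.
- move=> t ut; rewrite -mulr_sumr; apply: ler_wpM2l; last exact: sum_geo_pair.
  by rewrite /K !mulr_ge0 ?addr_ge0 ?sqr_ge0.
- by move=> N; rewrite undup_uniq.
- move=> N z; apply: le_trans (ler_normB _ _) _.
  have -> : (K * (geo R z.1 * geo R z.2))%:C =
    (W ^+ 2)%:C * (M1 * M2 * (geo R z.1 * geo R z.2))%:C
    + (M1 * M2 * (geo R z.1 * geo R z.2))%:C :> C R.
    by rewrite -rmorphM -rmorphD; congr (_%:C); rewrite /K; ring.
  have D0 : 0 <= (M1 * M2 * (geo R z.1 * geo R z.2))%:C :> C R.
    by rewrite ler0c !mulr_ge0 ?geo_ge0.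
  apply: lerD; case: ifP => _; rewrite ?normr0 //; last first.
    by rewrite mulr_ge0 // ler0c sqr_ge0.
  rewrite normrM; apply: ler_pM => //; rewrite normrM rmorphXn expr2.
  by apply: ler_pM.
case=> m n.
(* For large [N] the pair lies in both index sets, and its weights tend to 1. *)
have lim : (fun N => jweight p N m * jweight p N n * bpair x y (m, n) - bpair x y (m, n))
    @ \oo --> (1 * 1 * bpair x y (m, n) - bpair x y (m, n) : C R).
  apply: cvgB; last exact: cvg_cst.
  by apply: cvgM; [apply: cvgM; exact: cvg_jweight | exact: cvg_cst].
rewrite !mul1r subrr in lim.
apply: cvg_trans lim; apply: near_eq_cvg.
exists (absz m + absz n).+1 => // N /= hN.
by rewrite /f mem_zpairs mem_diamond // (_ : _ && _) //; lia.
Qed.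

(** The truncated theta product over [jconst N ^+ 2] differs from the bracket by a null sequence.
    The constant [h] is the same for all [x] and [y], so it cancels from the homogeneous Pluecker
    relation. *)
Lemma cvg_bracket : exists2 h : C R, h != 0 & forall x y, x != 0 -> y != 0 ->
  (fun N => bracket N x y) @ \oo --> theta p (x * y) * theta p (x / y) / h.
Proof.
have [h h0 hl] := cvg_jconst; exists (h ^+ 2); first by rewrite expf_neq0.
move=> x y x0 y0.
have j0 N : jconst p N != 0.
  by rewrite mulf_neq0 ?invr_eq0 ?expf_neq0 ?poch_self_neq0.
have l1 : (fun N => thetaN p (x * y) N * thetaN p (x / y) N / jconst p N ^+ 2) @ \oo -->
    theta p (x * y) * theta p (x / y) / h ^+ 2.
  apply: cvgM; first by apply: cvgM; exact: cvg_thetaN.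
  by apply: cvgV; [rewrite expf_neq0 | apply: cvg_sqr].
pose d N := \sum_(z <- zpairs N) jweight p N z.1 * jweight p N z.2 * bpair x y z
  - bracket N x y.
have l2 : (fun N => thetaN p (x * y) N * thetaN p (x / y) N / jconst p N ^+ 2 - d N)
    @ \oo --> (theta p (x * y) * theta p (x / y) / h ^+ 2 - 0 : C R).
  exact: cvgB l1 (cvg_bracket_diff x0 y0).
rewrite subr0 in l2; apply: cvg_trans l2; apply: near_eq_cvg; apply: nearW => N.
by rewrite thetaN_mul // /d mulrAC divff ?expf_neq0 // mul1r opprB addrC subrK.
Qed.

Lemma bracket_plucker N x y u v : x != 0 -> y != 0 -> u != 0 -> v != 0 ->
  bracket N x y * bracket N u v - bracket N x v * bracket N u y =
  u / y * (bracket N y v * bracket N x u).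
Proof. by move=> _ y0 _ _; exact: plucker_identity. Qed.

Lemma weierstrass_addition_neq0 x y u v : x != 0 -> y != 0 -> u != 0 -> v != 0 ->
  theta p (x * y) * theta p (x / y) * (theta p (u * v) * theta p (u / v))
  - theta p (x * v) * theta p (x / v) * (theta p (u * y) * theta p (u / y))
  = u / y * (theta p (y * v) * theta p (y / v) * (theta p (x * u) * theta p (x / u))).
Proof.
move=> x0 y0 u0 v0; have [h h0 hc] := cvg_bracket.
pose L x y := theta p (x * y) * theta p (x / y) / h.
have l1 : (fun N => bracket N x y * bracket N u v - bracket N x v * bracket N u y)
    @ \oo --> (L x y * L u v - L x v * L u y : C R).
  by apply: cvgB; apply: cvgM; exact: hc.
have l2 : (fun N => u / y * (bracket N y v * bracket N x u)) @ \oo -->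
    (u / y * (L y v * L x u) : C R).
  by apply: cvgMl_tmp; apply: cvgM; exact: hc.
have E : L x y * L u v - L x v * L u y = u / y * (L y v * L x u).
  have l3 : (fun N => bracket N x y * bracket N u v - bracket N x v * bracket N u y)
      @ \oo --> (u / y * (L y v * L x u) : C R).
    by apply: cvg_trans l2; apply: near_eq_cvg; apply: nearW => N; rewrite bracket_plucker.
  exact: (cvg_unique _ l1 l3).
exact: (divr_identity h0 E).
Qed.

End Weierstrass.

(** * The determinant transformation from the three-term relation *)

(* [K] is a [numClosedFieldType] rather than a [fieldType] so that instantiating
   it with [C R] yields literally the ring structures of the final statement. *)
Section EllipticDeterminant.
Variables (K : numClosedFieldType) (th : K -> K) (q : K).
Hypothesis q0 : q != 0.
Hypothesis three_term : forall a b c d l : K,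
  b != 0 -> c != 0 -> d != 0 -> l != 0 -> b * c * d * l = a ->
  th a * (th (l * b) * th (l * c) * th (l * d)) =
  th l * (th (a / b) * th (a / c) * th (a / d)) + l * th (a * l) * (th b * th c * th d).
Hypothesis th_divr_root : forall w, w != 0 -> th w = 0 ->
  exists k : K, exists m : int,
    k != 0 /\ forall x, x != 0 -> th (w / x) = k * x ^ m * th x.

Definition fac (a : K) (k : nat) : K := \prod_(i < k) th (a * q ^+ i).

Lemma fac0 a : fac a 0 = 1. Proof. by rewrite /fac big_ord0. Qed.

Lemma facS a k : fac a k.+1 = fac a k * th (a * q ^+ k).
Proof. by rewrite /fac big_ord_recr. Qed.

Lemma facSl a k : fac a k.+1 = th a * fac (a * q) k.
Proof.
rewrite /fac big_ord_recl expr0 mulr1; congr (_ * _).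
by apply: eq_bigr => i _; rewrite lift0 exprS mulrA.
Qed.

Lemma facD a k l : fac a (k + l) = fac a k * fac (a * q ^+ k) l.
Proof.
rewrite /fac big_split_ord; congr (_ * _).
by apply: eq_bigr => i _; rewrite /= exprD mulrA.
Qed.

Lemma fac_neq0P a k : (forall i, (i < k)%N -> th (a * q ^+ i) != 0) -> fac a k != 0.
Proof. by move=> h; apply/prodf_neq0 => i _; exact: h. Qed.

(* This is the Frenkel-Turaev summation read as a change of basis: only the
   leading coefficient [beta N] is needed, so the theta quotients in the other
   coefficients are left unnamed. Peeling the first factor off the left-hand
   side replaces [(a, l)] by [(a * q, l * q)]. *)
Lemma frenkel_turaev_expansion N : forall a l : K, a != 0 -> l != 0 ->
  (forall i, (i.+1 < N + N)%N -> th (a * q ^+ i) != 0) ->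
  exists beta : nat -> K,
    beta N = l ^+ N * fac (a * l * q ^+ N.-1) N / fac (a * q ^+ N.-1) N /\
    forall b c d, b != 0 -> c != 0 -> d != 0 -> b * c * d * l = a ->
      fac (l * b) N * fac (l * c) N * fac (l * d) N =
      \sum_(k < N.+1) beta k * (fac b k * fac c k * fac d k) *
        (fac (a * q ^+ k / b) (N - k) * fac (a * q ^+ k / c) (N - k)
          * fac (a * q ^+ k / d) (N - k)).
Proof.
elim: N => [|N IH] a l a0 l0 ha.
  exists (fun=> 1); split; first by rewrite !fac0 expr0 divr1 mulr1.
  by move=> b c d _ _ _ _; rewrite big_ord_recl big_ord0 !fac0 !mulr1 addr0.
have [|//|i hi|beta [betaN hbeta]] := IH (a * q) (l * q); rewrite ?mulf_neq0 //.
  by rewrite -mulrA -exprS; apply: ha; lia.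
(* These are the coefficients of the three-term relation at [a * q ^+ (k + k)], [b * q ^+ k],
   [c * q ^+ k], [d * q ^+ k], [l / q ^+ k]. Its first term completes the [k]-th summand for [a * q]
   to [G k], its second to [G k.+1]. *)
pose A k := th (l / q ^+ k) / th (a * q ^+ (k + k)).
pose B k := l / q ^+ k * th (a * l * q ^+ k) / th (a * q ^+ (k + k)).
(* The guard is there because nothing is known of [beta] beyond [N]. *)
pose gamma k := (if (k <= N)%N then A k * beta k else 0) +
  (if k is k'.+1 then B k' * beta k' else 0).
exists gamma; split.
  rewrite /gamma ltnn add0r /B betaN /= facSl [fac (a * _) _]facS.
  (* At [N = 0] the predecessor is truncated, but the factorials are then empty. *)
  have -> : fac (a * q * (l * q) * q ^+ N.-1) N = fac (a * l * q ^+ N * q) N.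
    by case: (N) => [|n]; rewrite ?fac0 //=; congr (fac _ _); rewrite !exprS; ring.
  have -> : fac (a * q * q ^+ N.-1) N = fac (a * q ^+ N) N.
    by case: (N) => [|n]; rewrite ?fac0 //=; congr (fac _ _); rewrite !exprS; ring.
  have fN : fac (a * q ^+ N) N != 0.
    by apply: fac_neq0P => i iN; rewrite -mulrA -exprD; apply: ha; lia.
  have tN : th (a * q ^+ N * q ^+ N) != 0 by rewrite -mulrA -exprD; apply: ha; lia.
  have qN : q ^+ N != 0 by rewrite expf_neq0.
  rewrite exprD (mulrA a) exprMn exprS.
  move: (th (a * q ^+ N * q ^+ N)) (fac (a * q ^+ N) N) (l ^+ N) (q ^+ N) tN fN qN.
  by move=> ? ? ? ? *; field; do ?[apply/andP; split].
move=> b c d b0 c0 d0 e1.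
pose G k := (fac b k * fac c k * fac d k) *
  (fac (a * q ^+ k / b) (N.+1 - k) * fac (a * q ^+ k / c) (N.+1 - k)
    * fac (a * q ^+ k / d) (N.+1 - k)).
under eq_bigr => k _ do rewrite -mulrA -/(G k).
rewrite /gamma; under eq_bigr => k _ do rewrite mulrDl.
rewrite big_split /= [X in _ = X + _]big_ord_recr [X in _ = _ + X]big_ord_recl /=.
rewrite ltnn !mul0r addr0 add0r -[RHS]big_split /=.
rewrite (facSl (l * b)) (facSl (l * c)) (facSl (l * d)).
rewrite [X in X * _ = _]mulrACA [LHS]mulrACA.
have e2 : b * c * d * (l * q) = a * q by rewrite mulrA e1.
have -> : fac (l * b * q) N * fac (l * c * q) N * fac (l * d * q) N =
    fac (l * q * b) N * fac (l * q * c) N * fac (l * q * d) N.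
  by rewrite (mulrAC l b) (mulrAC l c) (mulrAC l d).
rewrite (hbeta _ _ _ b0 c0 d0 e2) mulr_sumr; apply: eq_bigr => k _.
have kN : (k <= N)%N by rewrite -ltnS.
rewrite kN /bump add1n add0n.
have tk : th (a * q ^+ (k + k)) != 0 by apply: ha; lia.
have qk0 : q ^+ k != 0 by rewrite expf_neq0.
have := @three_term (a * q ^+ (k + k)) (b * q ^+ k) (c * q ^+ k) (d * q ^+ k) (l / q ^+ k).
rewrite !mulf_neq0 ?invr_eq0 // => /(_ isT isT isT isT) T.
have {T} : th (a * q ^+ (k + k)) * (th (l * b) * th (l * c) * th (l * d)) =
  th (l / q ^+ k) * (th (a * q ^+ k / b) * th (a * q ^+ k / c) * th (a * q ^+ k / d))
  + l / q ^+ k * th (a * l * q ^+ k) * (th (b * q ^+ k) * th (c * q ^+ k) * th (d * q ^+ k)).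
  have s x : l / q ^+ k * (x * q ^+ k) = l * x by field.
  have s' x : x != 0 -> a * q ^+ (k + k) / (x * q ^+ k) = a * q ^+ k / x.
    by move=> x0; rewrite exprD; field; apply/andP.
  have -> : a * l * q ^+ k = a * q ^+ (k + k) * (l / q ^+ k) by rewrite exprD; field.
  rewrite -(s b) -(s c) -(s d) -(s' b) // -(s' c) // -(s' d) //; apply: T.
  by rewrite -e1 exprD; field.
rewrite /G !facS subSn // !facSl subSS /A /B.
have s x : a * q ^+ k / x * q = a * q * q ^+ k / x by rewrite -!mulrA; congr (_ * _); ring.
have s' x : a * q ^+ k.+1 / x = a * q * q ^+ k / x by rewrite exprS mulrA.
rewrite !s !s' => T.
rewrite -[th (l * b) * _ * _](mulKf tk) T.
move: (th (a * q ^+ (k + k))) tk => u u0; by field; rewrite u0 qk0.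
Qed.


Definition fac3 (b c d : K) (k : nat) : K := fac b k * fac c k * fac d k.

(** * Transition matrix and degenerate parameters *)

Section Determinant.
Variables (n : nat) (a l t : K) (b c d : 'I_n -> K).
Hypotheses (a0 : a != 0) (l0 : l != 0).
Hypotheses (b0 : forall j, b j != 0) (c0 : forall j, c j != 0) (d0 : forall j, d j != 0).
Hypothesis bcd : forall j, b j * c j * d j = t.
Hypothesis tl : t * l = a.

Definition den (j : 'I_n) (k : nat) : K := fac3 (a / b j) (a / c j) (a / d j) k.

Hypothesis den0 : forall (j : 'I_n) (k : nat), (k < n)%N -> den j k != 0.

Definition mxl : 'M[K]_n := \matrix_(j, k) (fac3 (b j) (c j) (d j) k / den j k).
Definition mxr : 'M[K]_n :=
  \matrix_(j, k) (fac3 (l * b j) (l * c j) (l * d j) k / den j k).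

Lemma t_neq0 : t != 0.
Proof. by apply: contraNneq a0 => t0; rewrite -tl t0 mul0r. Qed.

(** The coefficients [beta] do not depend on the row, and [den j k] is [den j i] times the second
    factor of the [i]-th summand; so the expansion is a product with an upper triangular matrix,
    whose diagonal gives the determinant. *)
Lemma det_generic :
  (forall i, (i.+3 < n + n)%N -> th (a * q ^+ i) != 0) ->
  \det mxr = \det mxl *
    \prod_(k < n) (l ^+ k * fac (a * l * q ^+ k.-1) k / fac (a * q ^+ k.-1) k).
Proof.
move=> ha.
have ex (k : 'I_n) : exists beta : nat -> K,
    beta k = l ^+ k * fac (a * l * q ^+ k.-1) k / fac (a * q ^+ k.-1) k /\
    forall j : 'I_n, fac3 (l * b j) (l * c j) (l * d j) k =
      \sum_(i < k.+1) beta i * fac3 (b j) (c j) (d j) i *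
        fac3 (a * q ^+ i / b j) (a * q ^+ i / c j) (a * q ^+ i / d j) (k - i).
  have [|beta [betak hbeta]] := @frenkel_turaev_expansion k a l a0 l0.
    by move=> i hi; apply: ha; have := ltn_ord k; lia.
  exists beta; split => // j; apply: hbeta; rewrite ?bcd //.
have {ex} [beta hbeta] := choice ex.
pose T : 'M[K]_n := \matrix_(i, k) (if (i <= k)%N then beta k i else 0).
have -> : mxr = mxl *m T.
  apply/matrixP => j k; rewrite !mxE (proj2 (hbeta k) j).
  rewrite (big_ord_widen n (fun i => beta k i * fac3 (b j) (c j) (d j) i *
     fac3 (a * q ^+ i / b j) (a * q ^+ i / c j) (a * q ^+ i / d j) (k - i))) //.
  rewrite big_mkcond mulr_suml /=; apply: eq_bigr => i _; rewrite !mxE ltnS.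
  case: leqP => ik; rewrite ?mulr0 ?mul0r //.
  have split_fac x : x != 0 -> fac (a / x) k = fac (a / x) i * fac (a * q ^+ i / x) (k - i).
    by move=> x0; rewrite -{1}(subnKC ik) facD (mulrAC a).
  have dk : den j k = den j i *
      fac3 (a * q ^+ i / b j) (a * q ^+ i / c j) (a * q ^+ i / d j) (k - i).
    rewrite /den /fac3 !split_fac //; ring.
  have := den0 j (ltn_ord k); rewrite dk mulf_eq0 negb_or => /andP[di0 f0].
  by field; apply/andP.
rewrite det_mulmx; congr (_ * _).
rewrite -det_tr det_trig; last first.
  by apply/is_trig_mxP => i j ij; rewrite !mxE leqNgt ij.
by apply: eq_bigr => i _; rewrite !mxE leqnn (proj1 (hbeta i)).
Qed.

(* If [th (a * q ^+ i) = 0], then [th (a * q ^+ i / x)] is a monomial times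
   [th x], which makes columns [k] and [i + 1 - k] proportional. *)
Lemma det_degenerate i : (i.+3 < n + n)%N -> th (a * q ^+ i) = 0 -> \det mxl = 0.
Proof.
move=> hi hw.
have [kap [m [kap0 hkap]]] := th_divr_root (mulf_neq0 a0 (expf_neq0 i q0)) hw.
(* Reversing the factors: the last one, at [a / x * q ^+ k], equals [a * q ^+ i / (x * q ^+ k')] and
   is reflected to theta of [x * q ^+ k']. *)
have flip k k' : (k + k' = i.+1)%N -> exists2 s, s != 0 &
    forall x, x != 0 -> fac (a / x) k = s * (x ^ m) ^+ k * fac (x * q ^+ k') k.
  elim: k k' => [|k IH] k' e.
    by exists 1; rewrite ?oner_eq0 // => x x0; rewrite !fac0 expr0 !mulr1.
  have [|s s0 hs] := IH k'.+1; first by rewrite -e; lia.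
  exists (s * kap * (q ^+ k') ^ m) => [|x x0].
    by rewrite !mulf_neq0 // expfz_neq0 // expf_neq0.
  rewrite facS hs // facSl.
  have xq : x * q ^+ k' != 0 by rewrite mulf_neq0 // expf_neq0.
  have -> : a / x * q ^+ k = a * q ^+ i / (x * q ^+ k').
    have -> : q ^+ i = q ^+ k * q ^+ k' by rewrite -exprD; congr (_ ^+ _); lia.
    have qk' : q ^+ k' != 0 by rewrite expf_neq0.
    by field; apply/andP.
  rewrite hkap // expfzMl (exprSr q) (mulrA x) (exprS (x ^ m)); ring.
(* If [k = n - 1], then [i <= 2n - 4] gives [k' <= n - 2]; otherwise [k = i + 1] and [k' = 0]. *)
pose k := minn n.-1 i.+1; pose k' := (i.+1 - k)%N.
have [kn k'n kk' ekk'] : [/\ (k < n)%N, (k' < n)%N, k' != k & (k + k' = i.+1)%N].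
  by rewrite /k /k'; split; lia.
have [s s0 hs] := flip k k' ekk'.
have [s' s'0 hs'] := flip k' k (etrans (addnC _ _) ekk').
have tm0 : t ^ m != 0 by rewrite expfz_neq0 // t_neq0.
(* The monomials from the three reflections multiply to a power of [b j * c j * d j = t], hence are
   the same in every row. *)
pose r k := (t ^ m) ^+ k.
(* After cross-multiplication both sides are [fac3 (b j) (c j) (d j) i.+1]; this avoids dividing by
   it, as it may vanish. *)
have col j : mxl j (Ordinal kn) * (s ^+ 3 * r k) = mxl j (Ordinal k'n) * (s' ^+ 3 * r k').
  have denE u u' v : (forall x, x != 0 -> fac (a / x) u = v * (x ^ m) ^+ u * fac (x * q ^+ u') u) ->
      den j u = v ^+ 3 * r u * fac3 (b j * q ^+ u') (c j * q ^+ u') (d j * q ^+ u') u.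
    by move=> h; rewrite /den /fac3 !h // /r -(bcd j) !expfzMl !exprMn; ring.
  have split3 u u' : (u + u')%N = i.+1 -> fac3 (b j) (c j) (d j) u *
      fac3 (b j * q ^+ u) (c j * q ^+ u) (d j * q ^+ u) u' = fac3 (b j) (c j) (d j) i.+1.
    by move=> <-; rewrite /fac3 !facD; ring.
  have E1 := denE _ _ _ hs; have E2 := denE _ _ _ hs'.
  have := den0 j kn; have := den0 j k'n; rewrite !mxE /= E1 E2 => n2 n1.
  have e3 := split3 _ _ ekk'; have e4 := split3 _ _ (etrans (addnC _ _) ekk').
  have cancel (F u v G : K) : u * v * G != 0 -> F / (u * v * G) * (u * v) = F / G.
    rewrite !mulf_eq0 !negb_or => /andP[/andP[? ?] ?].
    by field; do ?[apply/andP; split].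
  have factor_neq0 (u G : K) : u * G != 0 -> G != 0.
    by rewrite mulf_eq0 negb_or => /andP[].
  rewrite (cancel _ _ _ _ n1) (cancel _ _ _ _ n2).
  have g1 := factor_neq0 _ _ n1; have g2 := factor_neq0 _ _ n2.
  by apply/eqP; rewrite eqr_div // e3 e4.
apply/eqP; rewrite -det_tr; apply/det0P.
pose v : 'rV[K]_n := (s ^+ 3 * r k) *: delta_mx 0 (Ordinal kn)
  - (s' ^+ 3 * r k') *: delta_mx 0 (Ordinal k'n).
exists v.
  apply/negP => /eqP /matrixP /(_ 0 (Ordinal kn)); rewrite !mxE !eqxx /=.
  have -> : (Ordinal kn == Ordinal k'n) = false by apply/negP => /eqP [] e; rewrite e eqxx in kk'.
  rewrite mulr0 subr0 mulr1 => /eqP; apply/negP.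
  by rewrite mulf_neq0 ?expf_neq0.
rewrite /v mulmxBl -!scalemxAl -!rowE; apply/matrixP => x j.
have := col j; rewrite !mxE => E; apply/eqP.
by rewrite subr_eq0 [_ * (_ / _)]mulrC E mulrC.
Qed.

Theorem det_mxl_transformation :
  (forall j : nat, (2 <= j <= n)%N -> fac (a * l * q ^+ (j - 2)) (j - 1) != 0) ->
  \det mxl = l^-1 ^+ 'C(n, 2) *
    (\prod_(2 <= j < n.+1) (fac (a * q ^+ (j - 2)) (j - 1) / fac (a * l * q ^+ (j - 2)) (j - 1)))
    * \det mxr.
Proof.
move=> he.
have he' k : (k < n)%N -> fac (a * l * q ^+ k.-1) k != 0.
  case: k => [|k] kn; first by rewrite fac0 oner_eq0.
  by have := he k.+2; rewrite !subSS !subn0; apply.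
have -> : l^-1 ^+ 'C(n, 2) * (\prod_(2 <= j < n.+1)
     (fac (a * q ^+ (j - 2)) (j - 1) / fac (a * l * q ^+ (j - 2)) (j - 1))) =
   \prod_(k < n) (l ^- k * (fac (a * q ^+ k.-1) k / fac (a * l * q ^+ k.-1) k)).
  rewrite [RHS]big_split /=; congr (_ * _).
    by rewrite -bin2_sum expr_sum big_mkord; apply: eq_bigr => k _; rewrite exprVn.
  case: (n) => [|n']; first by rewrite big_ord0 big_geq.
  rewrite big_add1 /= big_add1 /= big_mkord [RHS]big_ord_recl /= !fac0 divff ?oner_eq0 // mul1r.
  by apply: eq_bigr => k _; rewrite /bump leq0n add1n /= !subSS !subn0.
have [/forallP ha|] := boolP [forall i : 'I_(n + n), (i.+3 < n + n)%N ==> (th (a * q ^+ i) != 0)].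
  have {}ha i : (i.+3 < n + n)%N -> th (a * q ^+ i) != 0.
    move=> hi; have hi' : (i < n + n)%N by lia.
    by have /implyP := ha (Ordinal hi'); apply.
  rewrite (det_generic ha) mulrCA -big_split /= big1 ?mulr1 // => k _.
  have f1 := he' k (ltn_ord k).
  have f2 : fac (a * q ^+ k.-1) k != 0.
    apply: fac_neq0P => i ik; rewrite -mulrA -exprD; apply: ha.
    by have := ltn_ord k; lia.
  have f3 : l ^+ k != 0 by rewrite expf_neq0.
  by field; do ?[apply/andP; split].
rewrite negb_forall => /existsP[m]; rewrite negb_imply negbK => /andP[hi /eqP hw].
rewrite (det_degenerate hi hw).
(* The vanishing theta occurs in the factor with index k = floor((m + 1)/2) + 1, at position
   floor(m/2), because k - 1 + floor(m/2) = m. *)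
have kn : ((m.+1)./2.+1 < n)%N by have := odd_double_half m.+1; lia.
rewrite (bigD1 (Ordinal kn)) //= /fac.
have kh : (m./2 < m.+1./2.+1)%N by have := odd_double_half m.+1; have := odd_double_half m; lia.
rewrite (bigD1 (Ordinal kh)) //= -mulrA -exprD.
have -> : (m.+1./2 + m./2)%N = m.
  by have := odd_double_half m.+1; have := odd_double_half m; rewrite /=; lia.
by rewrite hw !(mul0r, mulr0).
Qed.

End Determinant.

Theorem determinant_transformation_from_three_term (a : K) (n : nat) (b c d : 'I_n -> K) :
  (0 < n)%N -> a != 0 ->
  (forall j, b j != 0) -> (forall j, c j != 0) -> (forall j, d j != 0) ->
  (forall j k, b j * c j * d j = b k * c k * d k) ->
  forall e : K, (forall j, e = a ^+ 2 / (b j * c j * d j)) ->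
  (forall (j : 'I_n) (k : nat), (k < n)%N ->
     fac (a / b j) k * fac (a / c j) k * fac (a / d j) k != 0) ->
  (forall j : nat, (2 <= j <= n)%N -> fac (e * q ^+ (j - 2)) (j - 1) != 0) ->
  \det (\matrix_(j < n, k < n)
          ((fac (b j) k * fac (c j) k * fac (d j) k) /
           (fac (a / b j) k * fac (a / c j) k * fac (a / d j) k)))
  = (a / e) ^+ 'C(n, 2) *
    (\prod_(2 <= j < n.+1)
        (fac (a * q ^+ (j - 2)) (j - 1) / fac (e * q ^+ (j - 2)) (j - 1))) *
    \det (\matrix_(j < n, k < n)
          ((fac (a / (b j * c j)) k * fac (a / (b j * d j)) k
              * fac (a / (c j * d j)) k) /
           (fac (a / b j) k * fac (a / c j) k * fac (a / d j) k))).
Proof.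
move=> n0 a0 b0 c0 d0 bcd e eE den0 he.
pose j0 := Ordinal n0; pose t := b j0 * c j0 * d j0; pose l := a / t.
have t0 : t != 0 by rewrite !mulf_neq0.
have l0 : l != 0 by rewrite mulf_neq0 ?invr_eq0.
have tl : t * l = a by rewrite mulrC divfK.
have e_eq : e = a * l by rewrite (eE j0) expr2 -mulrA.
have ae : a / e = l^-1 by rewrite e_eq invfM mulrA divff // mul1r.
have lE j : [/\ a / (c j * d j) = l * b j, a / (b j * d j) = l * c j & a / (b j * c j) = l * d j].
  by rewrite -tl /t -(bcd j); split; field; rewrite ?b0 ?c0 ?d0.
rewrite ae e_eq in he *.
have -> : \matrix_(j < n, k < n)
          ((fac (a / (b j * c j)) k * fac (a / (b j * d j)) k * fac (a / (c j * d j)) k) /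
           (fac (a / b j) k * fac (a / c j) k * fac (a / d j) k)) = mxr a l b c d.
  apply/matrixP => j k; rewrite !mxE; have [-> -> ->] := lE j.
  by rewrite /fac3 /den /fac3; congr (_ / _); ring.
exact: (@det_mxl_transformation n a l t b c d a0 l0 b0 c0 d0 (fun j => bcd j j0) tl den0 he).
Qed.

End EllipticDeterminant.

(** * The three-term relation for theta *)

(** The case [p = 0], where theta(x) = 1 - x; the series argument divides by powers of [p]. *)
Lemma weierstrass_trigonometric (K : fieldType) (x y u v : K) : y != 0 -> u != 0 -> v != 0 ->
  (1 - x * y) * (1 - x / y) * ((1 - u * v) * (1 - u / v))
  - (1 - x * v) * (1 - x / v) * ((1 - u * y) * (1 - u / y))
  = u / y * ((1 - y * v) * (1 - y / v) * ((1 - x * u) * (1 - x / u))).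
Proof. by move=> y0 u0 v0; field; rewrite y0 u0 v0. Qed.

(** Solving x y = a and x / y = l b forces x^2 = a l b; then u v = l c and u / v = l d fix [u] and
    [v] up to a common sign, and the other eight arguments follow from b c d l = a. *)
Lemma three_term_parameters (K : fieldType) (a b c d l x : K) :
  a != 0 -> b != 0 -> c != 0 -> d != 0 -> l != 0 -> b * c * d * l = a ->
  x != 0 -> x ^+ 2 = a * l * b ->
  let y := a / x in let u := a * l / x in let v := x * c / a in
  [/\ y != 0, u != 0 & v != 0] /\
  [/\ x * y = a, x / y = l * b, u * v = l * c & u / v = l * d] /\
  [/\ x * v = a / d, x / v = a / c, u * y = a / b & u / y = l] /\
  [/\ y * v = c, y / v = d, x * u = a * l & x / u = b].
Proof.
move=> a0 b0 c0 d0 l0 e x0 ex y u v.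
(* Eliminating [b] and [d] turns all claims into rational identities in [a], [c], [l], [x]. *)
have bE : b = x ^+ 2 / (a * l) by rewrite ex; field; rewrite a0 l0.
have dE : d = a ^+ 2 / (x ^+ 2 * c) by rewrite ex -e; field; rewrite l0 b0 c0 d0.
rewrite /y /u /v bE dE; split; first by split; rewrite !mulf_neq0 ?invr_eq0.
by split; [split|split; split]; field; rewrite ?a0 ?c0 ?l0 ?x0.
Qed.

Lemma three_term_rearrangement (K : comRingType) (a lb lc ld l ab ac ad al b c d l' : K) :
  a * lb * (lc * ld) = l' * (c * d * (al * b)) + ad * ac * (ab * l) ->
  a * (lb * lc * ld) = l * (ab * ac * ad) + l' * al * (b * c * d).
Proof. by move=> E; rewrite -(mulrA lb) mulrA E; ring. Qed.

Section Main.
Variable R : realType.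
Variable p : C R.
Hypothesis p1 : `|p| < 1.

Lemma theta0E (x : C R) : theta 0 x = 1 - x.
Proof.
have n0 : `|0 : C R| < 1 by rewrite normr0.
have qp0 : qpoch 0 0 = 1 :> C R.
  rewrite /qpoch (_ : poch 0 0 = fun=> 1) ?lim_cst //.
  by apply/funext => N; rewrite /poch big1 // => j _; rewrite mulr0 subr0.
by rewrite (thetaE n0) mul0r (qpoch_shift n0) mul0r qp0 !mulr1.
Qed.

Lemma weierstrass_addition (x y u v : C R) : x != 0 -> y != 0 -> u != 0 -> v != 0 ->
  theta p (x * y) * theta p (x / y) * (theta p (u * v) * theta p (u / v))
  - theta p (x * v) * theta p (x / v) * (theta p (u * y) * theta p (u / y))
  = u / y * (theta p (y * v) * theta p (y / v) * (theta p (x * u) * theta p (x / u))).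
Proof.
move=> x0 y0 u0 v0; have [->|p0] := eqVneq p 0.
  by rewrite !theta0E; exact: weierstrass_trigonometric.
exact: weierstrass_addition_neq0.
Qed.

(* The substitution turning the four-parameter addition formula into this form
   needs a square root of [a * l * b]. *)
Lemma theta_three_term (a b c d l : C R) :
  b != 0 -> c != 0 -> d != 0 -> l != 0 -> b * c * d * l = a ->
  theta p a * (theta p (l * b) * theta p (l * c) * theta p (l * d)) =
  theta p l * (theta p (a / b) * theta p (a / c) * theta p (a / d))
  + l * theta p (a * l) * (theta p b * theta p c * theta p d).
Proof.
move=> b0 c0 d0 l0 e.
have a0 : a != 0 by rewrite -e !mulf_neq0.
pose x := sqrtC (a * l * b); have ex : x ^+ 2 = a * l * b by rewrite sqrtCK.
have x0 : x != 0 by rewrite sqrtC_eq0 !mulf_neq0.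
have [[y0 u0 v0] [[e1 e2 e3 e4] [[e5 e6 e7 e8] [e9 e10 e11 e12]]]] :=
  three_term_parameters a0 b0 c0 d0 l0 e x0 ex.
have := weierstrass_addition x0 y0 u0 v0.
rewrite e1 e2 e3 e4 e5 e6 e7 e8 e9 e10 e11 e12 => /eqP.
rewrite subr_eq => /eqP.
exact: three_term_rearrangement.
Qed.
End Main.

Theorem theorem1p1 (R : realType) (p q a : C R) (n : nat)
  (b c d : 'I_n -> C R) :
  `|p| < 1 -> q != 0 -> (0 < n)%N -> a != 0 ->
  (forall j, b j != 0) -> (forall j, c j != 0) -> (forall j, d j != 0) ->
  (forall j k, b j * c j * d j = b k * c k * d k) ->
  forall e : C R, (forall j, e = a ^+ 2 / (b j * c j * d j)) ->
  (forall (j : 'I_n) (k : nat), (k < n)%N ->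
     efac p q (a / b j) k * efac p q (a / c j) k * efac p q (a / d j) k != 0) ->
  (forall j : nat, (2 <= j <= n)%N -> efac p q (e * q ^+ (j - 2)) (j - 1) != 0) ->
  \det (\matrix_(j < n, k < n)
          ((efac p q (b j) k * efac p q (c j) k * efac p q (d j) k) /
           (efac p q (a / b j) k * efac p q (a / c j) k * efac p q (a / d j) k)))
  = (a / e) ^+ 'C(n, 2) *
    (\prod_(2 <= j < n.+1)
        (efac p q (a * q ^+ (j - 2)) (j - 1) / efac p q (e * q ^+ (j - 2)) (j - 1))) *
    \det (\matrix_(j < n, k < n)
          ((efac p q (a / (b j * c j)) k * efac p q (a / (b j * d j)) k
              * efac p q (a / (c j * d j)) k) /
           (efac p q (a / b j) k * efac p q (a / c j) k * efac p q (a / d j) k))).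
Proof.
move=> p1 q0; exact: (@determinant_transformation_from_three_term _ (theta p) q q0
  (theta_three_term p1) (theta_divr_root p1)).
Qed.
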